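(* Define $a:\mathbb{Z}\to\mathbb{Z}$ by $a(n)=\left\lfloor \frac{n+1}{\sqrt{2}}\right\rfloor$ for $n\ge 1$ and $a(k)=0$ for $k<1$. Then \[ a\bigl(a(n)+a(n-1)\bigr)=n\qquad\text{for all integers } n\ge 1. \] *)

(* Defs.v *)
From Stdlib Require Import Reals ZArith.

Definition a (n : Z) : Z :=
  if (1 <=? n)%Z then Zfloor (IZR (n + 1) / sqrt 2)%R else 0%Z.

(* Main.v *)
(** Put r = sqrt 2, x = a n, y = a (n - 1), and let f, g be the fractional parts
    of (n + 1) / r and n / r.  Then x + y + 1 = n r + 1 / r + 1 - f - g.  Since
    x is y or y + 1, f is g + 1 / r or g + 1 / r - 1, and in both cases
    n r < x + y + 1 <= (n + 1) r; equality on the right would force f = 0, which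
    the irrationality of sqrt 2 excludes.  Dividing by r gives the claim. *)

Require Import Defs.
From Stdlib Require Import Reals ZArith Lra Lia.

(** Infinite descent: [p = 2k] and [q = 2l] give [2 * (l * l) = k * k], with [k < p] unless
    [k = 0]. *)
Lemma double_square_eq_square (p q : Z) :
  (0 <= p)%Z -> (2 * (q * q) = p * p)%Z -> p = 0%Z.
Proof.
  intros Hp; revert q; pattern p; apply Zlt_0_ind; [clear p Hp | exact Hp].
  intros p IH Hp q Hpq.
  destruct (Z.Even_or_Odd p) as [[k ->] | [k ->]]; [| lia].
  destruct (Z.Even_or_Odd q) as [[l ->] | [l ->]]; [| lia].
  destruct (Z.eq_dec k 0) as [-> | Hk]; [reflexivity |].
  rewrite (IH k ltac:(lia) l ltac:(lia)); reflexivity.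
Qed.

(** Clears the division, so that [nra] can work with [sqrt 2 * sqrt 2 = 2]. *)
Lemma div_sqrt2 (t : R) : (t / sqrt 2 = t * (sqrt 2 / 2))%R.
Proof.
  pose proof (sqrt_sqrt 2 ltac:(lra)) as Hr.
  pose proof Rlt_sqrt2_0 as Hpos.
  apply (Rmult_eq_reg_r (sqrt 2)); [| lra].
  field_simplify; [| lra].
  simpl; rewrite Rmult_1_r, Hr; field.
Qed.

Lemma div_sqrt2_neq_IZR (p q : Z) : (0 < p)%Z -> (IZR p / sqrt 2 <> IZR q)%R.
Proof.
  intros Hp H.
  pose proof (sqrt_sqrt 2 ltac:(lra)) as Hr.
  rewrite div_sqrt2 in H.
  enough (p = 0%Z) by lia.
  apply (double_square_eq_square p q); [lia |].
  apply eq_IZR; rewrite !mult_IZR, <- H.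
  replace (2 * (IZR p * (sqrt 2 / 2) * (IZR p * (sqrt 2 / 2))))%R
    with (IZR p * IZR p * (sqrt 2 * sqrt 2) / 2)%R by field.
  rewrite Hr; field.
Qed.

(** At [n = 0] the default value agrees with the floor, since [0 < 1 / sqrt 2 < 1]. *)
Lemma a_nonneg (n : Z) :
  (0 <= n)%Z -> a n = Zfloor (IZR (n + 1) / sqrt 2).
Proof.
  intros Hn; unfold a.
  destruct (Z.leb_spec 1 n) as [_ | H]; [reflexivity |].
  replace n with 0%Z by lia.
  symmetry; apply Zfloor_eq; rewrite div_sqrt2; simpl.
  pose proof (sqrt_sqrt 2 ltac:(lra)); pose proof Rlt_sqrt2_0; nra.
Qed.

Theorem theorem1p1 : forall n : Z, (1 <= n)%Z -> a (a n + a (n - 1))%Z = n.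
Proof.
  intros n Hn.
  assert (HnR : (1 <= IZR n)%R) by (apply IZR_le; exact Hn).
  pose proof (sqrt_sqrt 2 ltac:(lra)) as Hr.
  pose proof Rlt_sqrt2_0 as Hpos.
  rewrite (a_nonneg n), (a_nonneg (n - 1)) by lia.
  replace (n - 1 + 1)%Z with n by lia.
  destruct (Zfloor_bound (IZR (n + 1) / sqrt 2)) as [Hx1 Hx2].
  destruct (Zfloor_bound (IZR n / sqrt 2)) as [Hy1 Hy2].
  pose proof (div_sqrt2_neq_IZR (n + 1) (Zfloor (IZR (n + 1) / sqrt 2))
    ltac:(lia)) as Hx3.
  set (x := Zfloor (IZR (n + 1) / sqrt 2)) in *.
  set (y := Zfloor (IZR n / sqrt 2)) in *.
  rewrite div_sqrt2 in Hx1, Hx2, Hx3, Hy1, Hy2.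
  rewrite plus_IZR in Hx1, Hx2, Hx3.
  set (r := sqrt 2) in *.
  assert (Hr1 : (1.4 < r < 1.5)%R) by nra.
  (* Gives [0 <= x + y], so that [a_nonneg] applies to the outer [a]. *)
  assert (Hx0 : (-1 < x)%Z) by (apply lt_IZR; nra).
  assert (Hy0 : (-1 < y)%Z) by (apply lt_IZR; nra).
  assert (Hyx : (y - 1 < x)%Z) by (apply lt_IZR; rewrite minus_IZR; nra).
  assert (Hxy : (x < y + 2)%Z) by (apply lt_IZR; rewrite plus_IZR; nra).
  assert (Hs : (IZR n * r < IZR (x + y + 1) < (IZR n + 1) * r)%R).
  { rewrite !plus_IZR.
    (* If [x = y], the sum is [(n + 1) r + 1 - 2 f] with [f >= 1 / r > 1 / 2]; if [x = y + 1], it is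
       [(n + 1) r - 2 f], where [Hx3] gives [f > 0]. *)
    assert (Hcase : x = y \/ x = (y + 1)%Z) by lia.
    destruct Hcase as [E | E]; apply (f_equal IZR) in E;
      try rewrite plus_IZR in E; split; nra. }
  rewrite a_nonneg by lia.
  apply Zfloor_eq; rewrite div_sqrt2; fold r; nra.
Qed.
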